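(* There exists a constant $c > 1$ such that for all integers $l, n \geq 3$, $$\mathrm{ES}_{\ell}(l,n) \leq c\,(n+l-1)\binom{2n-4}{n-2}.$$
   Context: All lines are in the plane with fixed $x,y$ coordinates. A finite family of lines is in nearly general position if no two of its lines are parallel and no line is vertical. For a finite family $L$ of lines and $k \geq 2$, $L$ defines a $k$-cell $P$ if $P$ is a connected component of the complement of the union of the lines of $L$ and the boundary of $P$ contains a segment of positive length from exactly $k$ of the lines. A family of $n$ lines is in convex position if it defines an $n$-cell. Lines are concurrent if they all pass through a common point. For $n \geq 2$, $l \geq 3$, $\mathrm{ES}_{\ell}(l,n)$ denotes the minimum $N$ such that every family of $N$ lines in the plane in nearly general position contains either $l$ concurrent lines or a subfamily of $n$ lines in convex position. *)

(* Defs.v *)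
From HB Require Import structures.
From mathcomp Require Import all_boot all_order all_algebra.
From mathcomp Require Import all_classical all_reals all_analysis.
Set Implicit Arguments.
Unset Strict Implicit.
Unset Printing Implicit Defensive.
Import Order.TTheory GRing.Theory Num.Theory.
Import numFieldNormedType.Exports.
Local Open Scope classical_set_scope.
Local Open Scope card_scope.
Local Open Scope ring_scope.

(* Lines are point sets of the plane R * R, and a family of n lines is a set   *)
(* of lines of cardinality n, so its members are pairwise distinct.            *)
Section Lines.
Variable R : realType.
Implicit Types (A B P : set (R * R)) (L M : set (set (R * R))).

Definition is_line A :=
  exists a b c : R, (a, b) != (0, 0) /\
    A = [set p : R * R | a * p.1 + b * p.2 = c].

Definition vertical A := exists c : R, A = [set p : R * R | p.1 = c].

Definition parallel A B := A = B \/ A `&` B = set0.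

Definition nearly_general_position L :=
  [/\ finite_set L,
      forall A, L A -> is_line A,
      forall A B, L A -> L B -> A <> B -> ~ parallel A B
    & forall A, L A -> ~ vertical A].

Definition concurrent L := exists p : R * R, forall A, L A -> A p.

Definition boundary P := closure P `\` interior P.

Definition segment (p q : R * R) : set (R * R) :=
  [set p + t *: (q - p) | t in `[0 : R, 1]%classic].

Definition complement_component L P :=
  let U := ~` (\bigcup_(A in L) A) in
  exists2 p, U p & P = connected_component U p.

Definition defines_cell (k : nat) L P :=
  complement_component L P /\
  [set A | L A /\
     exists p q : R * R, p <> q /\ segment p q `<=` A `&` boundary P] #= `I_k.

Definition convex_position (n : nat) L :=
  L #= `I_n /\ exists P, defines_cell n L P.

Definition ES_property (l n N : nat) :=
  forall L, nearly_general_position L -> L #= `I_N ->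
    (exists M, [/\ M `<=` L, M #= `I_l & concurrent M]) \/
    (exists M, M `<=` L /\ convex_position n M).

(* ES_l(l, n) = N; as a relation, since the existence of a minimum is not      *)
(* known in advance.                                                           *)
Definition is_ES (l n N : nat) :=
  ES_property l n N /\ forall N', ES_property l n N' -> (N <= N')%N.

End Lines.

(* Main.v *)
(* A line y = a x + b is dual to the point (a, b): concurrent lines are dual to
   collinear points, and the lines dual to a cup (cap) all appear on a common
   lower (upper) envelope, hence bound one cell.  So take points with no n-cup,
   no n-cap and no l collinear points.  For a point q and a slope s let f(q, s)
   and g(q, s) be the sizes of the largest cup and cap ending at q whose last
   slope is at most s, respectively at least s.  The pairs (u, v) >= (2, 2)
   dominated by some (f(q, s), g(q, s)) form a down-set of an (n-2) x (n-2) grid,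
   and there are 'C(2n-4, n-2) of those.  If p and q have the same down-set and
   p is to the left of q, then f(p, .) jumps at the slope of pq; so inside such a
   class every point sees the points to its right in fewer than n directions.
   The class therefore spans at most n lines per point, and by the theorem of
   Beck (through the crossing lemma and the Szemeredi-Trotter bound) it has only
   O(n + l) points. *)
Require Import Defs.
From mathcomp Require Import all_boot all_order all_algebra.
From mathcomp Require Import all_classical all_reals all_analysis.
From mathcomp Require Import ring lra zify.
Set Implicit Arguments.
Unset Strict Implicit.
Unset Printing Implicit Defensive.
Import Order.TTheory GRing.Theory Num.Theory.
Import numFieldNormedType.Exports.
Local Open Scope ring_scope.

(** * Slopes and crossing segments *)

Section PlanarPoints.
Variables (R : realFieldType) (T : finType) (X Y : T -> R).

Definition slope (i j : T) : R := (Y j - Y i) / (X j - X i).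

Lemma slopeC i j : slope i j = slope j i.
Proof. by rewrite /slope -(opprB (Y i)) -(opprB (X i)) invrN mulrNN. Qed.

Lemma slopeE i j : X i < X j -> Y j = Y i + slope i j * (X j - X i).
Proof.
by move=> lt_ij; rewrite divfK ?subr_eq0 ?gt_eqF // addrC subrK.
Qed.

Lemma slope_convex i j k : X i < X j -> X j < X k ->
  slope i k * (X k - X i)
    = slope i j * (X j - X i) + slope j k * (X k - X j).
Proof.
move=> ij jk; have := slopeE (lt_trans ij jk).
by rewrite (slopeE jk) (slopeE ij); lra.
Qed.

(** By [slope_convex] the slope of [ik] is a mean of the other two with positive weights. *)
Lemma slope_between i j k : X i < X j -> X j < X k ->
  slope i j < slope j k -> slope i j < slope i k < slope j k.
Proof.
move=> ij jk lt; have h := slope_convex ij jk.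
have ik : 0 < X k - X i by lra.
apply/andP; split; rewrite -(ltr_pM2r ik) h; nra.
Qed.

(** Signed vertical distance from the line through the ends of [e] up to [z]. *)
Definition height (e : T * T) (z : T) : R :=
  Y z - (Y e.1 + slope e.1 e.2 * (X z - X e.1)).

(** For edges drawn left to right this is a proper crossing: a shared end or a mere contact gives
    height 0 and does not count. *)
Definition cross (e f : T * T) : bool :=
  (height e f.1 * height e f.2 < 0) && (height f e.1 * height f e.2 < 0).

Lemma crossC e f : cross e f = cross f e.
Proof. by rewrite /cross andbC. Qed.

(* Above [v b] over [v'], not above it over [w]: the edge [v' a'] crosses [v b],
   unless both contain the point [w]. *)
Lemma cross_above v b v' a' w :
    X v < X v' -> X v' < X w -> X w <= X b -> X w <= X a' ->
    slope v b < slope v v' -> slope v w <= slope v b ->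
    slope v' a' <= slope v' w ->
  cross (v, b) (v', a') \/
    slope v w = slope v b /\ slope v' w = slope v' a'.
Proof.
move=> vv' v'w wb wa' lt_s le_s le_s'.
have v'E := slopeE vv'; have wE := slopeE (lt_trans vv' v'w).
have wE' := slopeE v'w.
have bE := slopeE (lt_le_trans (lt_trans vv' v'w) wb).
have aE := slopeE (lt_le_trans v'w wa').
rewrite /cross /height /=.
set s := slope v b in lt_s le_s bE *.
set s' := slope v' a' in le_s' aE *.
(* The vertical distance from the line of [v b] up to that of [v' a'], an affine function: positive
   at [v'], nonpositive at [w]. If it is negative at [w] it decreases, and so changes sign along
   both edges; if it is 0 there, both slope bounds at [w] are tight. *)
pose g x := Y v' + s' * (x - X v') - (Y v + s * (x - X v)).
have gv' : 0 < g (X v').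
  have h : 0 < (slope v v' - s) * (X v' - X v) by apply: mulr_gt0; lra.
  by rewrite /g v'E; lra.
have gw : g (X w) <= 0.
  have h1 : 0 <= (s - slope v w) * (X w - X v) by apply: mulr_ge0; lra.
  have h2 : 0 <= (slope v' w - s') * (X w - X v') by apply: mulr_ge0; lra.
  rewrite /g; lra.
have [gw0|gw0] := ltrP (g (X w)) 0; last first.
  right.
  have h1 : 0 <= (s - slope v w) * (X w - X v) by apply: mulr_ge0; lra.
  have h2 : 0 <= (slope v' w - s') * (X w - X v') by apply: mulr_ge0; lra.
  have e1 : (s - slope v w) * (X w - X v) = 0 by rewrite /g in gw0; lra.
  have e2 : (slope v' w - s') * (X w - X v') = 0 by rewrite /g in gw0; lra.
  move/eqP: e1; rewrite mulf_eq0 => /orP[/eqP ? | /eqP ?]; last lra.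
  move/eqP: e2; rewrite mulf_eq0 => /orP[/eqP ? | /eqP ?]; last lra.
  by split; lra.
left.
have gE x : g x = g (X v') + (s' - s) * (x - X v') by rewrite /g; ring.
have ss' : s' - s < 0 by move: gw0; rewrite gE => ?; nra.
have ga : g (X a') < 0.
  have -> : g (X a') = g (X w) + (s' - s) * (X a' - X w) by rewrite /g; ring.
  have h : 0 <= (s - s') * (X a' - X w) by apply: mulr_ge0; lra.
  by lra.
have gb : g (X b) < 0.
  have -> : g (X b) = g (X w) + (s' - s) * (X b - X w) by rewrite /g; ring.
  have h : 0 <= (s - s') * (X b - X w) by apply: mulr_ge0; lra.
  by lra.
have gv : 0 < g (X v).
  have h : 0 < (s - s') * (X v' - X v) by apply: mulr_gt0; lra.
  by rewrite gE; lra.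
have -> : Y v' - (Y v + s * (X v' - X v)) = g (X v') by rewrite /g; ring.
have -> : Y a' - (Y v + s * (X a' - X v)) = g (X a') by rewrite /g aE; ring.
have -> : Y v - (Y v' + s' * (X v - X v')) = - g (X v) by rewrite /g; ring.
have -> : Y b - (Y v' + s' * (X b - X v')) = - g (X b) by rewrite /g bE; ring.
by rewrite mulrNN !pmulr_rlt0 // ga gb.
Qed.

End PlanarPoints.

(** * The crossing lemma *)

Section Reflection.
Variables (R : realFieldType) (T : finType) (X Y : T -> R).

Lemma slopeN i j : slope X (fun z => - Y z) i j = - slope X Y i j.
Proof. by rewrite /slope -mulNr opprD. Qed.

Lemma crossN e f : cross X (fun z => - Y z) e f = cross X Y e f.
Proof.
have heightN a z : height X (fun z => - Y z) a z = - height X Y a z.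
  by rewrite /height slopeN; ring.
by rewrite /cross !heightN !mulrNN.
Qed.

(** Reflection of [cross_above] in the x-axis, which negates slopes and keeps crossings. *)
Lemma cross_below v a v' b' w :
    X v < X v' -> X v' < X w -> X w <= X a -> X w <= X b' ->
    slope X Y v v' < slope X Y v a -> slope X Y v a <= slope X Y v w ->
    slope X Y v' w <= slope X Y v' b' ->
  cross X Y (v, a) (v', b') \/
    slope X Y v w = slope X Y v a /\ slope X Y v' w = slope X Y v' b'.
Proof.
move=> vv' v'w wa wb' h1 h2 h3.
have := @cross_above R T X (fun z => - Y z) v a v' b' w vv' v'w wa wb'.
rewrite !slopeN crossN ltrN2 !lerN2 => /(_ h1 h2 h3) [|[/oppr_inj e1 /oppr_inj e2]].
  by left.
by right.
Qed.

End Reflection.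

Section CrossingLemma.
Variables (R : realFieldType) (T : finType) (X Y : T -> R).
Hypothesis injX : injective X.
Local Notation slope := (slope X Y).
Local Notation cross := (cross X Y).

Implicit Types (A : {set T}) (F G : {set T * T}).

(** A straight-line graph with edges directed to the right and no vertex inside an edge; edges may
    cross. *)
Definition drawing (A : {set T}) (F : {set T * T}) : Prop :=
  forall e, e \in F -> [/\ e.1 \in A, e.2 \in A, X e.1 < X e.2 &
    forall z, z \in A -> X e.1 < X z -> X z < X e.2 ->
      slope e.1 z != slope e.1 e.2].

Lemma drawing_sub A F G : G \subset F -> drawing A F -> drawing A G.
Proof. by move=> /fintype.subsetP sGF dF e /sGF /dF. Qed.

Lemma drawing_slope_eq A F v b z : drawing A F -> (v, b) \in F -> z \in A ->
  X v < X z -> X z <= X b -> slope v z = slope v b -> z = b.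
Proof.
move=> dF vbF zA vz zb E; apply: injX; apply/eqP; rewrite eq_le zb /= leNgt.
apply/negP=> lt_zb.
by have [_ _ _ /(_ z zA vz lt_zb)] := dF _ vbF; rewrite E eqxx.
Qed.

Lemma drawing_slope_inj A F v a b : drawing A F -> (v, a) \in F ->
  (v, b) \in F -> slope v a = slope v b -> a = b.
Proof.
move=> dF va vb E; have [_ aA lt_va _] := dF _ va.
have [_ bA lt_vb _] := dF _ vb.
have [le_ab|/ltW le_ba] := lerP (X a) (X b).
  exact: (drawing_slope_eq dF vb aA lt_va le_ab E).
by apply/esym/(drawing_slope_eq dF va bA lt_vb le_ba); rewrite E.
Qed.

(* [a] is the edge at [v] just below [b], and [w] is the leftmost vertex of the
   closed wedge that they span. *)
Definition wedge_spec (A : {set T}) (F : {set T * T}) (v b a w : T) : Prop :=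
  [/\ (v, a) \in F, slope v a < slope v b,
      forall c, (v, c) \in F -> slope v c < slope v b -> slope v c <= slope v a,
      [/\ w \in A, X v < X w, slope v a <= slope v w & slope v w <= slope v b] &
      forall z, z \in A -> X v < X z -> slope v a <= slope v z ->
        slope v z <= slope v b -> X w <= X z].

Lemma wedge_exists A F v b c : drawing A F -> (v, b) \in F -> (v, c) \in F ->
  slope v c < slope v b -> exists a w, wedge_spec A F v b a w.
Proof.
move=> dF vb vc lt_cb.
pose P z := ((v, z) \in F) && (slope v z < slope v b).
have Pc : P c by rewrite /P vc lt_cb.
case: (Order.TotalTheory.arg_maxP (slope v) Pc) => a /andP[va lt_ab] amax.
have [_ bA lt_vb _] := dF _ vb.
pose W z := [&& z \in A, X v < X z, slope v a <= slope v z &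
  slope v z <= slope v b].
have Wb : W b by rewrite /W bA lt_vb (ltW lt_ab) lexx.
case: (Order.TotalTheory.arg_minP X Wb) => w /and4P[wA vw aw wb] wmin.
exists a, w; split=> //.
  by move=> d vd lt_db; apply: amax; rewrite /P vd lt_db.
by move=> z zA vz az zb; apply: wmin; apply/and4P.
Qed.

(* At most two wedges share the vertex [w]: one has it on its upper edge, the
   other one does not. *)
Lemma wedge_inj A F v b a v' b' a' w : drawing A F ->
    (forall e f, e \in F -> f \in F -> ~~ cross e f) ->
    (v, b) \in F -> (v', b') \in F ->
    wedge_spec A F v b a w -> wedge_spec A F v' b' a' w ->
    (w == b) = (w == b') -> (v, b) = (v', b').
Proof.
move=> dF nc.
wlog: v b a v' b' a' / X v <= X v'.
  move=> H vb vb' W W' E; have [le|/ltW le] := lerP (X v) (X v').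
    exact: H W W' E.
  by apply/esym; apply: H W' W _.
move=> le_vv' vb vb' [va lt_ab amax [wA vw aw wb] wmin]
  [va' lt_ab' amax' [_ v'w aw' wb'] wmin'] E.
have /= [_ bA ltvb _] := dF _ vb; have /= [_ aA ltva _] := dF _ va.
have /= [v'A b'A ltvb' _] := dF _ vb'; have /= [_ a'A ltva' _] := dF _ va'.
have le_wb : X w <= X b by apply: wmin => //; apply: ltW.
have le_wa : X w <= X a by apply: wmin => //; apply: ltW.
have le_wb' : X w <= X b' by apply: wmin' => //; apply: ltW.
have le_wa' : X w <= X a' by apply: wmin' => //; apply: ltW.
move: le_vv'; rewrite le_eqVlt => /orP[/eqP/injX vv'|lt_vv'].
  subst v'; congr pair.
  wlog: b b' a a' vb vb' va lt_ab amax aw wb wmin va' lt_ab' amax' aw' wb' wmin' E bA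
      ltvb aA ltva b'A ltvb' a'A ltva' le_wb le_wa le_wb' le_wa'
      / slope v b <= slope v b'.
    move=> H; have [le|/ltW le] := lerP (slope v b) (slope v b').
      by apply: (H b b' a a').
    by apply/esym; apply: (H b' b a' a).
  (* If [b'] is strictly above [b], the wedge below [b'] stays weakly above the edge [v b], so the
     common vertex [w] lies on that edge and equals [b]. *)
  rewrite le_eqVlt => /orP[/eqP|lt_bb'].
    exact: drawing_slope_inj dF vb vb'.
  have le_ba' := amax' _ vb lt_bb'.
  have wbE : slope v w = slope v b.
    by apply/eqP; rewrite eq_le wb (le_trans le_ba' aw').
  have := drawing_slope_eq dF vb wA vw le_wb wbE => w_b.
  by move: E; rewrite {1}w_b eqxx w_b => /esym/eqP.
exfalso.
(* Seen from [v], the vertex [v'] is above the wedge, below it or inside it. Outside, an edge of one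
   wedge crosses an edge of the other unless both end at [w], which [E] excludes; inside, [v']
   precedes [w], against the choice of [w]. *)
have [lt_s|le_s] := ltrP (slope v b) (slope v v').
  have [|[e1 e2]] := cross_above lt_vv' v'w le_wb le_wa' lt_s wb aw'.
    by apply/negP/nc.
  have w_b := drawing_slope_eq dF vb wA vw le_wb e1.
  have w_a' := drawing_slope_eq dF va' wA v'w le_wa' e2.
  move: E; rewrite {1}w_b eqxx w_a' => /esym/eqP a'b'.
  by move: lt_ab'; rewrite a'b' ltxx.
have [lt_s|le_s'] := ltrP (slope v v') (slope v a).
  have [|[e1 e2]] := cross_below lt_vv' v'w le_wa le_wb' lt_s aw wb'.
    by apply/negP/nc.
  have w_a := drawing_slope_eq dF va wA vw le_wa e1.
  have w_b' := drawing_slope_eq dF vb' wA v'w le_wb' e2.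
  move: E; rewrite {2}w_b' eqxx w_a => /eqP ab.
  by move: lt_ab; rewrite ab ltxx.
by have := wmin v' v'A lt_vv' le_s' le_s; rewrite leNgt v'w.
Qed.

(** A charging argument in place of Euler's formula. The lowest edge leaving a vertex is charged to
    that vertex; any other edge is charged to the leftmost vertex of its wedge, tagged by whether
    this is the end of the edge. By [wedge_inj] each vertex is charged at most once per tag, and
    there are three tags. *)
Lemma noncrossing_bound A F : drawing A F ->
    (forall e f, e \in F -> f \in F -> ~~ cross e f) ->
  (#|F| <= 3 * #|A|)%N.
Proof.
move=> dF nc.
pose low (e : T * T) := [forall c, ((e.1, c) \in F) ==> (slope e.1 e.2 <= slope e.1 c)].
have lowP v b : ~~ low (v, b) -> exists2 c, (v, c) \in F & slope v c < slope v b.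
  by case/forallPn=> c; rewrite negb_imply -ltNge => /andP[]; exists c.
have [g gP] : exists g : T * T -> T * option bool, forall e, e \in F ->
    if low e then g e = (e.1, None)
    else exists a w, wedge_spec A F e.1 e.2 a w /\ g e = (w, Some (w == e.2)).
  have H e : exists y : T * option bool, e \in F -> if low e then y = (e.1, None)
    else exists a w, wedge_spec A F e.1 e.2 a w /\ y = (w, Some (w == e.2)).
    case: (boolP (e \in F)) => [eF|_]; last by exists (e.1, None).
    have [le|nl] := boolP (low e); first by exists (e.1, None).
    case: e eF nl => v b vb /lowP[c vc lt_cb].
    have [a [w W]] := wedge_exists dF vb vc lt_cb.
    by exists (w, Some (w == b)) => _; exists a, w.
  apply: (@fin_all_exists _ _ (fun e (y : T * option bool) =>
    e \in F -> if low e then y = (e.1, None)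
    else exists a w, wedge_spec A F e.1 e.2 a w /\ y = (w, Some (w == e.2)))) => e.
  exact: H.
have ginj : {in F &, injective g}.
  move=> [v b] [v' b'] eF fF; have := gP _ eF; have := gP _ fF.
  case: ifPn => [lf|_]; case: ifPn => [le|_].
  - move=> -> -> [/= vv']; subst v'; congr pair.
    apply: (drawing_slope_inj dF eF fF); apply/eqP; rewrite eq_le.
    move/forallP: lf => /(_ b) /implyP /(_ eF) /= ->.
    by move/forallP: le => /(_ b') /implyP /(_ fF) /= ->.
  - by move=> -> [a [w [_ ->]]].
  - by move=> [a [w [_ ->]]] ->.
  move=> [a' [w' [W' ->]]] [a [w [W ->]]] [ww' Ew]; subst w'.
  exact: (wedge_inj dF nc eF fF W W' Ew).
rewrite -(card_in_imset ginj).
have -> : (3 * #|A| = #|finset.setX A [set: option bool]|)%N.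
  by rewrite cardsX cardsT card_option card_bool mulnC.
apply: subset_leq_card; apply/fintype.subsetP => y /imsetP[e eF ->].
have [eA _ _ _] := dF _ eF.
have := gP _ eF; case: ifP => _; first by move=> ->; rewrite finset.in_setX eA inE.
by move=> [a [w [[_ _ _ [wA _ _ _] _] ->]]]; rewrite finset.in_setX wA inE.
Qed.

Definition crossings (F : {set T * T}) : {set (T * T) * (T * T)} :=
  [set p | [&& p.1 \in F, p.2 \in F & cross p.1 p.2]].

(** Deleting an edge of a crossing costs one edge and at least one crossing; once no crossing is
    left, [noncrossing_bound] applies. *)
Lemma crossings_lower A F : drawing A F ->
  (#|F| <= 3 * #|A| + #|crossings F|)%N.
Proof.
have [n] := ubnP #|F|; elim: n F => // n IH F ltFn dF.
case: (set_0Vmem (crossings F)) => [cr0|[[e f]]].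
  rewrite cr0 cards0 addn0; apply: noncrossing_bound dF _ => e f eF fF.
  apply/negP => ef; have : (e, f) \in crossings F by rewrite inE /= eF fF.
  by rewrite cr0 inE.
rewrite inE /= => /and3P[eF fF ef].
have sub : F :\ e \subset F by apply: subD1set.
have cE : #|F| = (#|F :\ e|).+1 by rewrite (cardsD1 e) eF.
have lt : (#|crossings (F :\ e)| < #|crossings F|)%N.
  apply: proper_card; apply/properP; split.
    apply/fintype.subsetP=> p; rewrite !inE => /and3P[/andP[_ ->] /andP[_ ->] ->] //.
  by exists (e, f); rewrite !inE /= ?eqxx ?eF ?fF ?ef.
have ltFe : (#|F :\ e| < n)%N by rewrite -ltnS -cE.
rewrite cE; apply: leq_ltn_trans (IH _ ltFe (drawing_sub sub dF)) _.
by rewrite ltn_add2l.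
Qed.

End CrossingLemma.

(** The probability that a uniform random map to ['I_q.+1] vanishes on [B], with denominators
    cleared; it turns the averaging in the crossing lemma into counting. *)
Lemma card_ffun_fixed (T : finType) q (B : {set T}) :
  (#|[set f : {ffun T -> 'I_q.+1} | [forall x in B, f x == ord0]]| * q.+1 ^ #|B|
    = q.+1 ^ #|T|)%N.
Proof.
pose G (x : T) : pred 'I_q.+1 := if x \in B then pred1 ord0 else predT.
rewrite (_ : #|_| = #|family G|); last first.
  apply: eq_card => f; rewrite inE; apply/'forall_implyP/familyP => H x.
    by rewrite /G; case: ifP => // /H; rewrite inE.
  by move=> xB; have := H x; rewrite /G xB inE.
rewrite card_family foldrE big_image /=.
rewrite -prod_nat_const [in X in (_ * X)%N]big_mkcond -big_split /=.
rewrite -[#|T|]cardsT -prod_nat_const.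
apply: eq_big => [x|x _]; first by rewrite !inE.
rewrite /G; case: (x \in B).
  by rewrite card1 mul1n.
by rewrite muln1 cardT size_enum_ord.
Qed.

Section Amplification.
Variables (R : realFieldType) (T : finType) (X Y : T -> R).
Hypothesis injX : injective X.

Lemma height_ends (e : T * T) : X e.1 < X e.2 ->
  height X Y e e.1 = 0 /\ height X Y e e.2 = 0.
Proof.
move=> lt; split; first by rewrite /height; ring.
by rewrite /height {1}(slopeE Y lt); ring.
Qed.

(** The ends of [e] have height 0 over [e] and those of [f] do not. Four distinct ends make a
    crossing survive sampling with the fourth power of the vertex probability. *)
Lemma cross_distinct (e f : T * T) : X e.1 < X e.2 -> X f.1 < X f.2 ->
  cross X Y e f -> #|[set e.1; e.2; f.1; f.2]| = 4.
Proof.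
move=> lte ltf /andP[].
have [he1 he2] := height_ends lte.
move=> H _.
have n1 z : height X Y e z != 0 -> (z != e.1) && (z != e.2).
  by move=> h; apply/andP; split; apply: contraNneq h => ->; rewrite ?he1 ?he2.
have /andP[h1 h2] : (height X Y e f.1 != 0) && (height X Y e f.2 != 0).
  by rewrite -negb_or -mulf_eq0 lt_eqF.
have /andP[/negPf a1 /negPf a2] := n1 _ h1.
have /andP[/negPf b1 /negPf b2] := n1 _ h2.
have c1 : (e.2 == e.1) = false by apply: contraTF lte => /eqP ->; rewrite ltxx.
have c2 : (f.2 == f.1) = false by apply: contraTF ltf => /eqP ->; rewrite ltxx.
by rewrite -!finset.setUA !cardsU1 cards1 !inE ![e.1 == _]eq_sym ![e.2 == f.1]eq_sym
  ![e.2 == f.2]eq_sym ![f.1 == f.2]eq_sym ?[e.2 == e.1]eq_sym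
  a1 a2 b1 b2 c2 ?[e.1 == e.2]eq_sym c1.
Qed.

(* The deletion bound, averaged over vertex sets in which each vertex is kept
   with probability [1 / q]: these are the fibres over 0 of all maps to ['I_q]. *)
Theorem crossing_lemma (F : {set T * T}) q : drawing X Y [set: T] F -> (0 < q)%N ->
  (#|F| * q ^ 2 <= #|crossings X Y F| + 3 * #|T| * q ^ 3)%N.
Proof.
case: q => // q dF _.
pose A (f : {ffun T -> 'I_q.+1}) := [set x | f x == ord0].
pose FA f := [set e in F | (e.1 \in A f) && (e.2 \in A f)].
have dFA f : drawing X Y (A f) (FA f).
  move=> e; rewrite inE => /andP[/dF[_ _ lt ne] /andP[e1 e2]].
  by split=> // z _; apply: ne; rewrite inE.
have bound f := crossings_lower injX (dFA f).
(* Expectations with denominators cleared: an edge survives with probability [1 / q.+1 ^ 2], a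
   vertex with [1 / q.+1], a crossing with at most [1 / q.+1 ^ 4]. *)
have cE : ((\sum_f #|FA f|) * q.+1 ^ 2 = #|F| * q.+1 ^ #|T|)%N.
  under eq_bigr => f _ do rewrite -sum1_card big_mkcond /=.
  rewrite exchange_big /= -sum_nat_const [in RHS]big_mkcond !big_distrl /=.
  apply: eq_bigr => e _; case: ifP => [eF|neF]; last first.
    by rewrite big1 // => f _; rewrite inE neF.
  have [_ _ lt _] := dF _ eF.
  rewrite -(@card_ffun_fixed T q [set e.1; e.2]) cards2.
  have -> : e.1 != e.2 by apply: contraTN lt => /eqP ->; rewrite ltxx.
  congr muln; rewrite -sum1_card [RHS]big_mkcond; apply: eq_bigr => f _.
  rewrite !inE eF /=; congr (if _ then _ else _).
  apply/andP/'forall_implyP => [[h1 h2] x|H].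
    by rewrite !inE => /orP[] /eqP ->.
  by split; apply: H; rewrite !inE eqxx ?orbT.
have cA : ((\sum_f #|A f|) * q.+1 = #|T| * q.+1 ^ #|T|)%N.
  under eq_bigr => f _ do rewrite -sum1_card big_mkcond /=.
  rewrite exchange_big /= -sum_nat_const !big_distrl /=.
  apply: eq_bigr => x _.
  rewrite -[RHS](@card_ffun_fixed T q [set x]) cards1.
  congr muln; rewrite -sum1_card [RHS]big_mkcond; apply: eq_bigr => f _.
  rewrite !inE /=; congr (if _ then _ else _).
  apply/idP/'forall_implyP => [h1 y|H]; first by rewrite inE => /eqP ->.
  by apply: H; rewrite inE.
have cC : ((\sum_f #|crossings X Y (FA f)|) * q.+1 ^ 4
    <= #|crossings X Y F| * q.+1 ^ #|T|)%N.
  under eq_bigr => f _ do rewrite -sum1_card big_mkcond /=.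
  rewrite exchange_big /= -sum_nat_const [leqRHS]big_mkcond !big_distrl /=.
  apply: leq_sum => -[e e'] _; case: ifP => [|necr]; last first.
    rewrite big1 // => f _; case: ifP => //; rewrite !inE /= => H.
    by move: necr; rewrite inE /=; case/and3P: H => /andP[-> _] /andP[-> _] ->.
  rewrite inE /= => /and3P[eF e'F ee'].
  have [_ _ lt _] := dF _ eF; have [_ _ lt' _] := dF _ e'F.
  rewrite -(@card_ffun_fixed T q [set e.1; e.2; e'.1; e'.2]).
  rewrite (cross_distinct lt lt' ee') leq_mul2r; apply/orP; right.
  rewrite -sum1_card [leqRHS]big_mkcond; apply: leq_sum => f _.
  case: ifP => //; rewrite !inE /= => /and3P[/and3P[_ h1 h2] /and3P[_ h3 h4] _].
  case: ifPn => //; apply: contraNT => _; apply/'forall_implyP => x.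
  by rewrite !inE => /orP[/orP[/orP[]|]|] /eqP ->.
rewrite -(@leq_pmul2r (q.+1 ^ #|T|)%N) ?expn_gt0 //.
have sum : (\sum_f #|FA f| <= 3 * (\sum_f #|A f|) + \sum_f #|crossings X Y (FA f)|)%N.
  by rewrite big_distrr -big_split /=; apply: leq_sum => f _; apply: bound.
move: (q.+1 ^ #|T|)%N cE cA cC => M cE cA cC.
rewrite mulnAC -cE -mulnA -expnD (leq_trans (leq_mul sum (leqnn _))) //.
rewrite !mulnDl addnC leq_add //.
by rewrite -mulnA (expnS _ 3) [(_ * (_ * _))%N]mulnA cA; apply/eq_leq; lia.
Qed.

End Amplification.

(** * Rich lines *)

Lemma affine_root (R : realFieldType) (a b x1 x2 : R) : x1 < x2 ->
  (a * x1 + b) * (a * x2 + b) < 0 -> x1 < - b / a < x2.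
Proof.
move=> lt H; have a0 : a != 0.
  by apply: contraTneq H => ->; rewrite !mul0r !add0r -leNgt -expr2 sqr_ge0.
set r := - b / a; have bE : b = - (a * r) by rewrite /r; field.
move: H; rewrite bE -!mulrBr mulrACA -expr2 pmulr_rlt0 ?exprn_even_gt0 // => H.
by apply/andP; split; rewrite ltNge; apply/negP => ?; nra.
Qed.

(** Here [t] lines with at least [k] of the [n] points each carry [t * k.-1] edges or more, with at
    most [t ^ 2] crossings; the hypothesis is the crossing lemma for that drawing. *)
Lemma szemeredi_trotter_arith n t k :
    (1 < k)%N -> (forall q, 0 < q -> t * k.-1 * q ^ 2 <= t ^ 2 + 3 * n * q ^ 3)%N ->
  (t * k ^ 3 <= 12 * n * k ^ 2 + 2304 * n ^ 2)%N.
Proof.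
move=> k1 H; have [->|t0] := posnP t; first by rewrite mul0n.
(* The optimal sampling rate is [1 / q] with [q] about [t * k / (12 * n)]. *)
have [lt|le] := ltnP (t * k) (12 * n).
  apply: leq_trans (leq_addr _ _).
  by rewrite (expnS k 2) mulnA leq_mul2r ltnW ?orbT.
apply: leq_trans (leq_addl _ _).
have [n0|n0] := posnP n.
  (* Without points the hypothesis at [q = t.+1] bounds [t * k.-1 * t.+1 ^ 2] by [t ^ 2], which is
     absurd. *)
  have := H 1%N isT; have := H t.+1 isT; rewrite n0 !muln0 !mul0n !addn0.
  rewrite !expnS !expn0 !muln1 => h _.
  have : (t * k.-1 * (t.+1 * t.+1) >= t * 1 * (t.+1 * t.+1))%N.
    by rewrite leq_mul2r leq_mul2l; apply/orP; right; apply/orP; right; lia.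
  nia.
pose q := ((t * k) %/ (12 * n))%N.
have q0 : (0 < q)%N by rewrite divn_gt0 ?muln_gt0.
have lo : (q * (12 * n) <= t * k)%N by apply: leq_trunc_div.
have hi : (t * k <= 24 * n * q)%N.
  have : (t * k < q.+1 * (12 * n))%N by rewrite -ltn_divLR ?muln_gt0.
  nia.
have kk : (k <= 2 * k.-1)%N by lia.
have h2 : (t * k * q ^ 2 <= 4 * t ^ 2)%N.
  have := H q q0.
  have : (t * k * q ^ 2 <= t * (2 * k.-1) * q ^ 2)%N.
    by rewrite leq_mul2r leq_mul2l kk !orbT.
  have : (q * (12 * n) * q ^ 2 <= t * k * q ^ 2)%N by rewrite leq_mul2r lo orbT.
  rewrite (expnS q 2); lia.
have h3 : (k * q ^ 2 <= 4 * t)%N.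
  by rewrite -(leq_pmul2l t0); move: h2; rewrite (expnS t 1) expn1; lia.
have h4 : ((t * k) ^ 2 <= (24 * n * q) ^ 2)%N by rewrite leq_exp2r.
have h5 : ((t * k) ^ 2 * k <= (24 * n) ^ 2 * (4 * t))%N.
  apply: leq_trans (leq_mul h4 (leqnn k)) _.
  by rewrite expnMn -mulnA leq_mul2l [(_ * k)%N]mulnC h3 orbT.
rewrite -(leq_pmul2l t0); apply: leq_trans (_ : (t * k) ^ 2 * k <= _)%N.
  by rewrite expnMn (expnS k 2) (expnS t 1) expn1; apply/eq_leq; lia.
by apply: leq_trans h5 _; rewrite expnMn; apply/eq_leq; lia.
Qed.

Section RichLines.
Variables (R : realFieldType) (T : finType) (X Y : T -> R).
Hypothesis injX : injective X.
Local Notation slope := (slope X Y).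

Definition graph (s c : R) : {set T} := [set z | Y z == s * X z + c].

Definition line_through (i j : T) : {set T} :=
  graph (slope i j) (Y i - slope i j * X i).

Definition is_graph (l : {set T}) : Prop := exists s c, l = graph s c.

Lemma neqX i j : i != j -> X i - X j != 0.
Proof. by rewrite subr_eq0 (inj_eq injX). Qed.

Lemma graph_slope s c i j : i \in graph s c -> j \in graph s c -> i != j ->
  slope i j = s.
Proof.
rewrite !inE => /eqP iE /eqP jE; rewrite eq_sym => /neqX ne.
by rewrite /slope iE jE; field.
Qed.

Lemma line_through_graph s c i j :
  i \in graph s c -> j \in graph s c -> i != j -> line_through i j = graph s c.
Proof.
move=> ig jg ne; rewrite /line_through (graph_slope ig jg ne).
by congr graph; move: ig; rewrite inE => /eqP ->; rewrite addrC addKr.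
Qed.

Lemma line_throughP i j z : i != z ->
  (z \in line_through i j) = (slope i z == slope i j).
Proof.
rewrite eq_sym => /neqX ne; rewrite inE; set s := slope i j.
apply/eqP/eqP => H; first by rewrite /slope H; field.
by rewrite -H /slope; field.
Qed.

Lemma line_through_l i j : i \in line_through i j.
Proof. by rewrite inE; apply/eqP; ring. Qed.

Lemma line_through_r i j : i != j -> j \in line_through i j.
Proof. by move=> ne; rewrite line_throughP. Qed.

Definition consecutive (l : {set T}) (e : T * T) : bool :=
  [&& e.1 \in l, e.2 \in l, X e.1 < X e.2 &
    [forall z in l, ~~ ((X e.1 < X z) && (X z < X e.2))]].

Implicit Types (l : {set T}) (e f : T * T).

Lemma consecutive_line l e : is_graph l -> consecutive l e ->
  line_through e.1 e.2 = l.
Proof.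
move=> [s [c ->]] /and4P[e1 e2 lt _]; apply: line_through_graph => //.
by apply: contraTN lt => /eqP ->; rewrite ltxx.
Qed.

(** Every point of [l] except the rightmost one, [m], has a right neighbour. *)
Lemma consecutive_lb l : (#|l|.-1 <= #|[set e | consecutive l e]|)%N.
Proof.
have [->|[x0 x0l]] := set_0Vmem l; first by rewrite cards0.
case: (@Order.TotalTheory.arg_maxP _ _ _ x0 (fun y => y \in l) X x0l) => m ml mmax.
have -> : #|l|.-1 = #|l :\ m| by rewrite (cardsD1 m) ml.
apply: leq_trans (leq_imset_card fst _).
apply: subset_leq_card; apply/fintype.subsetP => x; rewrite !inE => /andP[xm xl].
have lt_xm : X x < X m by rewrite lt_neqAle (inj_eq injX) xm; exact: mmax.
have Pm : (m \in l) && (X x < X m) by rewrite ml.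
case: (@Order.TotalTheory.arg_minP _ _ _ m (fun y => (y \in l) && (X x < X y)) X Pm).
move=> y /andP[yl lt_xy] ymin; apply/imsetP; exists (x, y) => //.
rewrite inE; apply/and4P; split=> //=; apply/'forall_implyP => z zl.
by apply/negP => /andP[lt1]; apply/negP; rewrite -leNgt; apply: ymin; rewrite zl.
Qed.

Lemma consecutive_uniq l e e' r : consecutive l e -> consecutive l e' ->
  X e.1 < r < X e.2 -> X e'.1 < r < X e'.2 -> e = e'.
Proof.
have half d d' : consecutive l d -> consecutive l d' ->
    X d.1 < r < X d.2 -> X d'.1 < r < X d'.2 -> X d.1 <= X d'.1 /\ X d'.2 <= X d.2.
  move=> /and4P[d1 d2 lt _] /and4P[d1' d2' lt' /'forall_implyP H].
  move=> /andP[a b] /andP[a' b']; split; rewrite leNgt; apply/negP => h.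
    by have := H _ d1; rewrite h (lt_trans a b').
  by have := H _ d2; rewrite h (lt_trans a' b).
move=> ce ce' er er'; have [a b] := half _ _ ce ce' er er'.
have [a' b'] := half _ _ ce' ce er' er.
case: e e' {half ce ce' er er'} a b a' b' => [x y] [x' y'] /= a b a' b'.
by congr pair; apply: injX; apply/eqP; rewrite eq_le ?a ?b ?a' ?b'.
Qed.

Definition intercept e : R := Y e.1 - slope e.1 e.2 * X e.1.

(** The quotient is the abscissa where the two lines meet; it depends on the lines only, not on the
    edges chosen on them. *)
Lemma cross_meet e f : X e.1 < X e.2 -> cross X Y e f ->
  X e.1 < - (intercept e - intercept f) / (slope e.1 e.2 - slope f.1 f.2) < X e.2.
Proof.
move=> lt /andP[_ H]; apply: affine_root => //; move: H.
rewrite /height [Y e.2](slopeE Y lt) => H; rewrite /intercept.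
by apply: le_lt_trans H; rewrite le_eqVlt; apply/orP; left; apply/eqP; ring.
Qed.

Variables (k : nat) (Ls : {set {set T}}).
Hypothesis k_gt1 : (1 < k)%N.
Hypothesis LsP : forall l, l \in Ls -> is_graph l.
Hypothesis Ls_rich : forall l, l \in Ls -> (k <= #|l|)%N.

Definition line_edges : {set T * T} := [set e | [exists l in Ls, consecutive l e]].

Lemma line_edgesP e : e \in line_edges ->
  line_through e.1 e.2 \in Ls /\ consecutive (line_through e.1 e.2) e.
Proof.
rewrite inE => /'exists_andP[l [lL le]].
by rewrite (consecutive_line (LsP lL) le).
Qed.

Lemma line_edges_drawing : drawing X Y [set: T] line_edges.
Proof.
move=> e /line_edgesP[_ /and4P[_ _ lt /'forall_implyP H]]; split=> // z _ lt1 lt2.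
apply/negP => sE; have ne : e.1 != z by apply: contraTN lt1 => /eqP ->; rewrite ltxx.
by have := H z; rewrite line_throughP // sE lt1 lt2 => /(_ isT).
Qed.

Lemma line_edges_lb : (#|Ls| * k.-1 <= #|line_edges|)%N.
Proof.
rewrite -[#|line_edges|]sum1_card.
rewrite (partition_big (fun e => line_through e.1 e.2) (mem Ls)) /=; last first.
  by move=> e /line_edgesP[].
rewrite -sum_nat_const; apply: leq_sum => l lL.
have kl : (k.-1 <= #|l|.-1)%N by have := Ls_rich lL; lia.
apply: leq_trans kl (leq_trans (consecutive_lb l) _).
rewrite sum1dep_card; apply: subset_leq_card; apply/fintype.subsetP => e; rewrite !inE => ce.
rewrite (consecutive_line (LsP lL) ce) eqxx andbT.
by apply/'exists_andP; exists l.
Qed.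

(** A crossing is determined by its ordered pair of lines: they meet at one abscissa, and on each
    line only one edge passes over it. *)
Lemma line_edges_crossings : (#|crossings X Y line_edges| <= #|Ls| ^ 2)%N.
Proof.
pose phi (p : (T * T) * (T * T)) :=
  (line_through p.1.1 p.1.2, line_through p.2.1 p.2.2).
have inj : {in crossings X Y line_edges &, injective phi}.
  move=> [e f] [e' f']; rewrite [_ \in _]inE => /and3P[/= eF fF ef].
  rewrite [_ \in _]inE => /and3P[/= eF' fF' ef'] [Ee Ef].
  have key a b a' b' : a \in line_edges -> b \in line_edges ->
      a' \in line_edges -> b' \in line_edges -> cross X Y a b -> cross X Y a' b' ->
      line_through a.1 a.2 = line_through a'.1 a'.2 ->
      line_through b.1 b.2 = line_through b'.1 b'.2 -> a = a'.
    move=> /line_edgesP[_ ca] /line_edgesP[_ cb] /line_edgesP[_ ca'].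
    move=> /line_edgesP[_ cb'] ab ab' Ea Eb.
    have sc d d' : consecutive (line_through d.1 d.2) d ->
        line_through d.1 d.2 = line_through d'.1 d'.2 -> slope d.1 d.2 = slope d'.1 d'.2
        /\ intercept d = intercept d'.
      move=> cd E; have := cd; rewrite {1}E => /and4P[d1 d2 lt _].
      have sE : slope d.1 d.2 = slope d'.1 d'.2.
        by apply: graph_slope d1 d2 _; apply: contraTN lt => /eqP ->; rewrite ltxx.
      by split=> //; rewrite /intercept sE; move: d1; rewrite inE => /eqP ->; ring.
    have [sa ia] := sc _ _ ca Ea; have [sb ib] := sc _ _ cb Eb.
    have lta : X a.1 < X a.2 by case/and4P: ca.
    have lta' : X a'.1 < X a'.2 by case/and4P: ca'.
    have := cross_meet lta ab; have := cross_meet lta' ab'.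
    rewrite -sa -sb -ia -ib => h' h.
    by apply: consecutive_uniq h h'; first exact: ca; rewrite Ea.
  rewrite (key _ _ _ _ eF fF eF' fF' ef ef' Ee Ef).
  by rewrite (key _ _ _ _ fF eF fF' eF' _ _ Ef Ee) // crossC.
rewrite -(card_in_imset inj) -mulnn -cardsX; apply: subset_leq_card.
apply/fintype.subsetP => y /imsetP[[e f]]; rewrite [_ \in _]inE => /and3P[/= eF fF _] ->.
by rewrite finset.in_setX; have [-> _] := line_edgesP eF; have [-> _] := line_edgesP fF.
Qed.

Lemma szemeredi_trotter_nat :
  (#|Ls| * k ^ 3 <= 12 * #|T| * k ^ 2 + 2304 * #|T| ^ 2)%N.
Proof.
apply: szemeredi_trotter_arith => // q q0.
apply: leq_trans (_ : #|line_edges| * q ^ 2 <= _)%N.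
  by rewrite leq_mul2r line_edges_lb orbT.
apply: leq_trans (crossing_lemma injX line_edges_drawing q0) _.
by rewrite leq_add2r line_edges_crossings.
Qed.

End RichLines.

(** The bound [O(n / k + n ^ 2 / k ^ 3)] for lines with at least [k] of [n] points, multiplied by
    [k ^ 3]. *)
Definition szemeredi_trotter_bound (a b : nat) : Prop :=
  forall (R : realFieldType) (T : finType) (X Y : T -> R), injective X ->
  forall (k : nat) (Ls : {set {set T}}), (1 < k)%N ->
    (forall L, L \in Ls -> is_graph X Y L) ->
    (forall L, L \in Ls -> (k <= #|L|)%N) ->
  (#|Ls| * k ^ 3 <= a * #|T| * k ^ 2 + b * #|T| ^ 2)%N.

Theorem szemeredi_trotter : exists a b, szemeredi_trotter_bound a b.
Proof.
exists 12%N, 2304%N => R T X Y injX k Ls k1 LsP Lsk.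
by apply (szemeredi_trotter_nat injX k1 LsP Lsk).
Qed.

(** * Beck's theorem for points with few directions *)

Lemma sum_inv_sqr_le (a b : rat) (t : nat -> rat) (K m : nat) :
    (1 < K)%N -> (K <= m)%N -> 0 <= a -> 0 <= b ->
    (forall s, (K <= s)%N -> t s <= a + b / (s%:R ^+ 2)) ->
  \sum_(K <= s < m) t s <= a * m%:R + b / K.-1%:R.
Proof.
move=> K1 Km a0 b0 H.
have pos s : (1 < s)%N -> 0 < s.-1%:R :> rat by move=> ?; rewrite ltr0n; lia.
have K0 := pos _ K1.
(* Strengthened for induction: [1 / s ^ 2] is at most [1 / s.-1 - 1 / s], and these differences
   telescope. *)
suff main : \sum_(K <= s < m) t s <= a * m%:R + b / K.-1%:R - b / m.-1%:R.
  apply: le_trans main _; rewrite gerBl divr_ge0 //; apply/ltW/pos; lia.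
have [d ->] : exists d, m = (K + d)%N by exists (m - K)%N; lia.
elim: d => [|d IH].
  rewrite addn0 big_geq // addrK mulr_ge0 //.
rewrite addnS big_nat_recr ?leq_addr //=.
set s := (K + d)%N in IH *; have s1 : (1 < s)%N by rewrite /s; lia.
have Ks : (K <= s)%N by apply: leq_addr.
have := H s Ks.
have e : 1 / (s%:R ^+ 2) <= 1 / s.-1%:R - 1 / s%:R :> rat.
  have s0 := pos _ s1; have -> : s%:R = s.-1%:R + 1 :> rat.
    by rewrite -[in LHS](ltn_predK s1) -natr1.
  move: (s.-1%:R : rat) s0 => x x0.
  have -> : 1 / x - 1 / (x + 1) = 1 / (x * (x + 1)) :> rat.
    by field; rewrite !lt0r_neq0 //; lra.
  rewrite !div1r lef_pV2 ?posrE; nra.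
have := ler_wpM2l b0 e; rewrite mulrBr !mulrA !mulr1 => e' h.
have : a * s.+1%:R = a * s%:R + a by rewrite -natr1 mulrDr mulr1.
move: IH; lra.
Qed.

(** The terms below [K] sum to at most [k ^ 2 / 8], a quarter of [k ^ 2 / 2], so the tail keeps more
    than a third of [k ^ 2]. *)
Lemma sqr_le_sum K k : (2 * K <= k)%N ->
  (k ^ 2 <= 3 * \sum_(K <= s < k.+1) s)%N.
Proof.
move=> Kk.
have main d : (2 * \sum_(K <= s < (K + d).+1) s = (K + d) * (K + d).+1 - K * K.-1)%N.
  elim: d => [|d IH]; first by rewrite addn0 big_nat1; nia.
  rewrite addnS big_nat_recr /=; last by lia.
  rewrite mulnDr IH; nia.
have := main (k - K)%N; rewrite subnKC; last by lia.
move=> E; rewrite -(leq_pmul2l (isT : 0 < 2)%N) mulnCA E; nia.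
Qed.

Lemma card_lt_pairs (R : realFieldType) (T : finType) (X : T -> R) : injective X ->
  (#|[set p : T * T | (X p.1 < X p.2)%R]| * 2 + #|T| = #|T| ^ 2)%N.
Proof.
move=> injX.
have swap : #|[set p : T * T | (X p.2 < X p.1)%R]| = #|[set p : T * T | (X p.1 < X p.2)%R]|.
  rewrite -(card_imset _ (can_inj (@swap_pairK T T))); congr #|pred_of_set _|.
  apply/finset.setP => -[x y]; apply/imsetP/idP => [[[a b]]|].
    by rewrite !inE /= => ? [-> ->].
  by rewrite inE /= => ?; exists (y, x); rewrite ?inE.
have diag : #|[set p : T * T | p.1 == p.2]| = #|T|.
  have inj : injective (fun x : T => (x, x)) by move=> ? ? [].
  rewrite -cardsT -(card_imset _ inj); congr #|pred_of_set _|.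
  apply/finset.setP => -[x y]; rewrite inE /=; apply/eqP/imsetP => [->|[z _ [-> ->]]//].
  by exists y.
rewrite muln2 -addnn -{1}swap -{1}diag -mulnn -card_prod.
have cardE (A : {set T * T}) : #|A| = (\sum_p (p \in A))%N.
  by rewrite -sum1_card big_mkcond; apply: eq_bigr => p _; case: (p \in A).
rewrite -cardsT !cardE -!big_split /=; apply: eq_bigr => -[x y] _.
by rewrite !inE /= -(inj_eq injX); case: ltgtP.
Qed.

Section Beck.
Variables (R : realFieldType) (T : finType) (X Y : T -> R).
Hypothesis injX : injective X.
Local Notation slope := (slope X Y).
Local Notation line := (line_through X Y).
Variables (a b r l K : nat).
Hypothesis stP : szemeredi_trotter_bound a b.
Hypothesis K_gt1 : (1 < K)%N.
Hypothesis few_directions : forall x, exists h : T -> 'I_r,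
  forall y z, X x < X y -> X x < X z -> h y = h z -> slope x y = slope x z.
Hypothesis few_collinear : forall s c, (#|graph X Y s c| < l)%N.

(** A left end sees at most [r] directions, and in each of them a poor line holds fewer than [2 * K]
    points. *)
Lemma poor_pairs_bound :
  (#|[set p : T * T | (X p.1 < X p.2)%R && (#|line p.1 p.2| < 2 * K)%N]|
    <= #|T| * (r * (2 * K)))%N.
Proof.
rewrite -sum1_card (partition_big fst predT) //= -sum_nat_const.
apply: leq_sum => x _; have [h hP] := few_directions x.
rewrite (partition_big (fun p => h p.2) predT) //=.
rewrite -[in leqRHS](card_ord r) -sum_nat_const; apply: leq_sum => i _.
rewrite sum1dep_card.
set S := finset _; have [->|[p0 p0S]] := set_0Vmem S; first by rewrite cards0.
move: p0S; rewrite !inE => /andP[/andP[/andP[lt0 poor] /eqP x0] /eqP i0].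
have inj : {in S &, injective snd}.
  move=> [x1 y1] [x2 y2]; rewrite !inE /= => /andP[/andP[_ /eqP ->] _].
  by move=> /andP[/andP[_ /eqP ->] _] ->.
apply: ltnW; apply: leq_ltn_trans poor; rewrite -(card_in_imset inj).
apply: subset_leq_card; apply/fintype.subsetP => y /imsetP[[x1 y1] yS ->]; rewrite !inE /= in yS.
move: yS => /andP[/andP[/andP[lt1 _] /eqP x1x] /eqP hy]; rewrite x1x in lt1.
rewrite line_throughP // ?x0; last first.
  by apply: contraTN lt1 => /eqP ->; rewrite ltxx.
by apply/eqP/hP => //; rewrite ?hy -?x0.
Qed.

Definition lines_from : {set {set T}} :=
  [set line p.1 p.2 | p : T * T in [set p : T * T | (X p.1 < X p.2)%R]].

(** A rich line [L] carries at most [#|L| ^ 2] pairs, which [sqr_le_sum] spreads over the thresholds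
    [s <= #|L|]; exchanging the sums leaves the number of lines above each threshold. *)
Lemma rich_pairs_bound :
  (#|[set p : T * T | (X p.1 < X p.2)%R && (2 * K <= #|line p.1 p.2|)%N]|
    <= 3 * \sum_(K <= s < l) s * #|[set L in lines_from | (s <= #|L|)%N]|)%N.
Proof.
pose rich := [set L in lines_from | (2 * K <= #|L|)%N].
rewrite -sum1_card (partition_big (fun p => line p.1 p.2) (mem rich)) /=; last first.
  move=> p; rewrite !inE => /andP[lt ->]; rewrite andbT.
  by apply/imsetP; exists p; rewrite ?inE.
apply: leq_trans (_ : \sum_(L in rich) 3 * \sum_(K <= s < l | (s <= #|L|)%N) s <= _)%N.
  apply: leq_sum => L; rewrite inE => /andP[LL richL].
  have Ll : (#|L| < l)%N.
    by case/imsetP: LL => p _ ->; apply: few_collinear.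
  apply: leq_trans (_ : #|L| ^ 2 <= _)%N.
    rewrite -mulnn -cardsX sum1dep_card; apply: subset_leq_card.
    apply/fintype.subsetP => p; rewrite !inE => /andP[/andP[lt _] /eqP <-].
    rewrite line_through_l line_through_r //.
    by apply: contraTN lt => /eqP ->; rewrite ltxx.
  apply: leq_trans (sqr_le_sum richL) _; rewrite leq_mul2l /=.
  rewrite (@big_cat_nat _ _ _ #|L|.+1 K l) //=; last by lia.
  rewrite -[leqLHS]addn0 leq_add //.
  rewrite [leqRHS]big_nat_cond [leqLHS]big_nat_cond.
  rewrite big_mkcond [leqRHS]big_mkcond; apply: leq_sum => s _.
  by case: ifP => // /andP[/andP[-> h] _]; rewrite h /= -[(s <= #|L|)%N]ltnS h.
rewrite -big_distrr leq_mul2l /=.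
under eq_bigr => L _ do rewrite big_mkcond.
rewrite exchange_big /=; apply: leq_sum => s _.
rewrite -big_mkcondr /= sum_nat_const mulnC leq_mul2l; apply/orP; right.
apply: subset_leq_card; apply/fintype.subsetP => L; rewrite inE => /andP[LR sL].
by move: LR; rewrite !inE sL => /andP[-> _].
Qed.

Lemma rich_lines_bound s : (K <= s)%N ->
  (s * #|[set L in lines_from | (s <= #|L|)%N]|)%:R
    <= (a * #|T|)%:R + (b * #|T| ^ 2)%:R / s%:R ^+ 2 :> rat.
Proof.
move=> Ks; set Ls := finset _.
have s1 : (1 < s)%N by lia.
have LsP L : L \in Ls -> is_graph X Y L.
  by rewrite inE => /andP[/imsetP[p _ ->] _]; eexists; eexists.
have Ls_rich L : L \in Ls -> (s <= #|L|)%N by rewrite inE => /andP[].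
have := stP injX s1 LsP Ls_rich.
rewrite -(ler_nat rat) => H.
have s0 : 0 < s%:R ^+ 2 :> rat by rewrite exprn_gt0 // ltr0n; lia.
rewrite -(ler_pM2r s0) mulrDl mulfVK ?lt0r_neq0 //.
rewrite -natrX -natrM -natrM -natrD.
by apply: le_trans H; rewrite ler_nat; apply/eq_leq; ring.
Qed.

(** Every left-to-right pair is poor or rich. The first summand bounds the poor pairs; the second
    bounds the rich ones, by summing the Szemeredi-Trotter bound over the thresholds. *)
Lemma beck_count : (2 * K <= l)%N ->
  (#|T|%:R ^+ 2 - #|T|%:R) / 2%:R <=
    #|T|%:R * (r%:R * (2 * K%:R))
     + 3 * (a%:R * #|T|%:R * l%:R + b%:R * #|T|%:R ^+ 2 / K.-1%:R) :> rat.
Proof.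
move=> Kl; have := card_lt_pairs injX.
set S := finset _; pose Q p := (#|line p.1 p.2| < 2 * K)%N.
have -> : #|S| = (#|[set p | (X p.1 < X p.2)%R && Q p]| +
    #|[set p | (X p.1 < X p.2)%R && (2 * K <= #|line p.1 p.2|)]|)%N.
  rewrite -(cardsID [set p | Q p] S); congr addn; apply: eq_card => p.
    by rewrite !inE.
  by rewrite !inE andbC /Q -leqNgt.
have h1 := poor_pairs_bound; have h2 := rich_pairs_bound.
have h3 : (\sum_(K <= s < l) s * #|[set L in lines_from | (s <= #|L|)%N]|)%:R
    <= (a * #|T|)%:R * l%:R + (b * #|T| ^ 2)%:R / K.-1%:R :> rat.
  rewrite natr_sum; apply: sum_inv_sqr_le rich_lines_bound => //; first by lia.
move: h1 h2 h3; rewrite /Q.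
set A := #|_|; set B := #|[set p | _ && (_ <= _)%N]|; set C := (\sum_(_ <= _ < _) _)%N.
rewrite -(ler_nat rat) => h1; rewrite -(ler_nat rat) => h2 h3 E.
have := congr1 (fun n : nat => n%:R : rat) E.
rewrite !(natrD, natrM, natrX) in h1 h2 h3 *; lra.
Qed.

End Beck.

(** Here [q] stands for [b / K.-1]: the term [3 * q * n ^ 2] is at most [n ^ 2 / 4], the left side
    absorbs it, and a factor [n] cancels. *)
Lemma few_directions_arith (F : realFieldType) (n r l a K q : F) :
    0 < n -> 1 <= l -> 0 <= r -> 0 <= a -> 1 <= K -> q <= 1 / 12 ->
    (n ^+ 2 - n) / 2 <= n * (r * (2 * K)) + 3 * (a * n * (l + 2 * K) + q * n ^+ 2) ->
  n <= (8 * K + 12 * a * (1 + 2 * K) + 2) * (r + l).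
Proof.
move=> n0 l1 r0 a0 K1 q1 H.
have Hq : 0 <= (1 / 12 - q) * n ^+ 2 by apply: mulr_ge0; [lra|exact: sqr_ge0].
have H' : n * (n / 4 - 1 / 2) <= n * (r * (2 * K) + 3 * (a * (l + 2 * K))).
  by move: (n ^+ 2) (expr2 n) H Hq => m mE H Hq; lra.
rewrite ler_pM2l // in H'.
have p1 : 0 <= a * r by rewrite mulr_ge0.
have p2 : 0 <= a * K * r by rewrite !mulr_ge0 //; lra.
have p3 : 0 <= a * K * (l - 1) by rewrite !mulr_ge0 //; lra.
have p4 : 0 <= K * (l - 1) by rewrite mulr_ge0 //; lra.
by lra.
Qed.

Theorem few_directions_bound : exists C : nat,
  forall (R : realFieldType) (T : finType) (X Y : T -> R) (r l : nat),
    injective X -> (0 < l)%N ->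
    (forall x, exists h : T -> 'I_r, forall y z, X x < X y -> X x < X z ->
      h y = h z -> slope X Y x y = slope X Y x z) ->
    (forall s c, (#|graph X Y s c| < l)%N) ->
  (#|T| <= C * (r + l))%N.
Proof.
have [a [b stP]] := szemeredi_trotter.
pose K := (12 * b.+1).+1.
exists (8 * K + 12 * a * (1 + 2 * K) + 2)%N => R T X Y r l injX l0 dirs coll.
have K_gt1 : (1 < K)%N by rewrite /K; lia.
(* [beck_count] asks for a collinearity bound of at least [2 * K], so [l] is enlarged. *)
have coll' s c : (#|graph X Y s c| < l + 2 * K)%N.
  by apply: leq_trans (coll s c) (leq_addr _ _).
have := beck_count injX stP K_gt1 dirs coll' (leq_addl _ _).
have KE : K.-1%:R = 12 * (b%:R + 1) :> rat by rewrite /K natrM natr1.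
(* With this [K] the quadratic term is at most half of the left-hand side. *)
have bK : b%:R / K.-1%:R <= 1 / 12 :> rat.
  have b0 : 0 <= b%:R :> rat by rewrite ler0n.
  by rewrite KE ler_pdivrMr; lra.
have [->|T0] := posnP #|T|; first by [].
rewrite [b%:R * _ / _]mulrAC.
have T1 : 0 < #|T|%:R :> rat by rewrite ltr0n.
have l1 : 1 <= l%:R :> rat by rewrite ler1n.
have K0 : 1 <= K%:R :> rat by rewrite ler1n.
rewrite [(l + _)%:R]natrD [(2 * K)%:R]natrM.
move/(few_directions_arith T1 l1 (ler0n _ r) (ler0n _ a) K0 bK).
by rewrite -(ler_nat rat) !(natrD, natrM).
Qed.

(** * Cups, caps and profiles *)

Section Cups.
Variables (R : realFieldType) (T : finType) (X Y : T -> R).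
Local Notation slope := (slope X Y).
Implicit Types (S : {set T}) (b : bool) (s : R).

Definition cup S : bool :=
  [forall i, forall j, forall k,
    [&& i \in S, j \in S, k \in S, X i < X j & X j < X k] ==>
      (slope i j < slope j k)].

Lemma cupP S : reflect (forall i j k, i \in S -> j \in S -> k \in S ->
  X i < X j -> X j < X k -> slope i j < slope j k) (cup S).
Proof.
apply: (iffP forallP) => [H i j k iS jS kS ij jk|H i].
  by move/forallP: (H i) => /(_ j) /forallP /(_ k); rewrite iS jS kS ij jk.
apply/forallP=> j; apply/forallP => k; apply/implyP => /and5P[*].
by apply: H.
Qed.

Lemma cup_sub S S' : S' \subset S -> cup S -> cup S'.
Proof.
move=> /fintype.subsetP sub /cupP H; apply/cupP => i j k iS jS kS.
by apply: H; apply: sub.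
Qed.

(** The bound [s], weak if [b] and strict otherwise, is put on all chords into [q]; in a cup the
    last chord is the steepest, so this bounds the last slope. *)
Definition cup_ending b (q : T) s S : bool :=
  [&& q \in S, cup S & [forall p in S, (p != q) ==>
    ((X p < X q) && (slope p q < s ?<= if b))]].

Lemma cup_endingP b q s S : reflect [/\ q \in S, cup S & forall p, p \in S ->
  p != q -> X p < X q /\ slope p q < s ?<= if b] (cup_ending b q s S).
Proof.
apply: (iffP and3P) => -[qS cS H]; split=> //.
  by move=> p pS pq; move/'forall_implyP: H => /(_ p pS) /implyP /(_ pq) /andP.
by apply/'forall_implyP => p pS; apply/implyP => pq; apply/andP/H.
Qed.

(** [cup_len true] is the function [f] of the overview; [cup_len false] is its value just before the
    slope [s], so that a jump at [s] is a strict inequality between the two. *)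
Definition cup_len b q s : nat := \max_(S | cup_ending b q s S) #|S|.

Lemma cup_len_gt0 b q s : (0 < cup_len b q s)%N.
Proof.
rewrite -(cards1 q); apply: (@leq_bigmax_cond _ _ (fun S => #|S|)).
apply/cup_endingP; split; first by rewrite inE.
  by apply/cupP => i j k; rewrite !inE => /eqP -> /eqP -> _; rewrite ltxx.
by move=> p; rewrite inE => ->.
Qed.

Lemma cup_len_lt b q s n : (forall S, cup S -> #|S| < n)%N -> (cup_len b q s < n)%N.
Proof.
case: n => [|n] H.
  by have /H : cup finset.set0 by apply/cupP => i j k; rewrite inE.
by rewrite ltnS; apply/bigmax_leqP => S /cup_endingP[_ /H].
Qed.

Lemma cup_len_mono q s s' : s < s' -> (cup_len true q s <= cup_len false q s')%N.
Proof.
move=> lt; apply/bigmax_leqP => S /cup_endingP[qS cS H].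
apply: (@leq_bigmax_cond _ _ (fun S => #|S|)); apply/cup_endingP; split=> //.
move=> p pS pq; have [lp] := H p pS pq => /= ls; split=> //=.
exact: le_lt_trans ls lt.
Qed.

(** A longest cup ending at [p] with slopes below [s] is extended by [q]: by [slope_between] its
    chords into [q] have slope at most [s]. *)
Lemma cup_len_step p q : X p < X q ->
  (cup_len false p (slope p q) < cup_len true q (slope p q))%N.
Proof.
move=> lt_pq; set s := slope p q.
have [S Send ->] : exists2 S, cup_ending false p s S & cup_len false p s = #|S|.
  (* A maximum over no set at all would be 0, which [cup_len_gt0] excludes. *)
  have [/pred0P none|/pred0Pn[S0 S0end]] := boolP (pred0b (cup_ending false p s)).
    have := cup_len_gt0 false p s; rewrite /cup_len big1 // => S.
    by have := none S => /= ->.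
  rewrite /cup_len (bigop.bigmax_eq_arg S0) //.
  by case: arg_maxnP => // S HS _; exists S.
have /cup_endingP[pS /cupP cS H] := Send.
have ltS x : x \in S -> X x < X q.
  move=> xS; have [->//|ne] := eqVneq x p.
  by have [lx _] := H x xS ne; apply: lt_trans lx lt_pq.
have qS : q \notin S by apply/negP => /ltS; rewrite ltxx.
have slopes x : x \in S -> x != p -> slope x q < s.
  move=> xS ne; have [lx /= ls] := H x xS ne.
  by case/andP: (slope_between lx lt_pq ls).
rewrite -add1n -[1%N]/(true : nat) -{1}qS -cardsU1.
apply: (@leq_bigmax_cond _ _ (fun S => #|S|)); apply/cup_endingP; split.
- exact: finset.setU11.
- apply/cupP => i j k; rewrite !inE.
  have [->|nk] := eqVneq k q; last first.
    move=> iS jS /= kS ij jk; have ltk := ltS _ kS.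
    case/orP: iS => [/eqP iq|iS]; first by move: (lt_trans ij jk); rewrite iq ltNge ltW.
    case/orP: jS => [/eqP jq|jS]; first by move: jk; rewrite jq ltNge ltW.
    exact: cS.
  move=> iS jS _ ij jq.
  case/orP: jS => [/eqP jq'|jS]; first by move: jq; rewrite jq' ltxx.
  case/orP: iS => [/eqP iq'|iS].
    by move: (lt_trans ij jq); rewrite iq' ltxx.
  have [jp|jp] := eqVneq j p.
    have ip : i != p by apply: contraTN ij => /eqP ->; rewrite jp ltxx.
    by rewrite jp; have [_] := H i iS ip.
  have [lj /= ls] := H j jS jp.
  apply: lt_trans (cS _ _ _ iS jS pS ij lj) _.
  by case/andP: (slope_between lj lt_pq ls).
- move=> x; rewrite !inE => /orP[/eqP ->|xS]; first by rewrite eqxx.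
  move=> _; split; first exact: ltS.
  have [->//=|ne] := eqVneq x p.
  exact/ltW/slopes.
Qed.

End Cups.

Lemma initial_segment_eq m (A B : {set 'I_m}) :
    (forall i j : 'I_m, (i <= j)%N -> j \in A -> i \in A) ->
    (forall i j : 'I_m, (i <= j)%N -> j \in B -> i \in B) ->
  #|A| = #|B| -> A = B.
Proof.
wlog sub : A B / A \subset B.
  move=> H dA dB E; have [sub|/fintype.subsetPn[a aA aB]] := boolP (A \subset B).
    exact: H.
  apply/esym/H => //; apply/fintype.subsetP => b bB.
  by have [le|/ltnW le] := leqP b a; [apply: dA aA|case/negP: aB; apply: dB bB].
by move=> _ _ E; apply/eqP; rewrite eqEcard sub E leqnn.
Qed.

(* Caps are the cups of the points reflected in the x-axis; slopes change sign. *)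
Section Profiles.
Variables (R : realFieldType) (T : finType) (X Y : T -> R) (m : nat).
Local Notation slope := (slope X Y).
Local Notation Yo := (fun z => - Y z).
Local Notation cap_len := (cup_len X Yo).
Local Notation cup_len := (cup_len X Y).
Hypothesis no_cup : forall S, cup X Y S -> (#|S| < m.+2)%N.
Hypothesis no_cap : forall S, cup X Yo S -> (#|S| < m.+2)%N.

(** Membership in the down-set of the overview, with [s] ranging over the slopes of chords that
    reach [q] from the left. *)
Definition dominated (q : T) (u v : nat) : bool :=
  [exists p, [&& X p < X q, (u <= cup_len true q (slope p q))%N &
    (v <= cap_len true q (- slope p q))%N]].

Lemma dominated_le q u v u' v' : (u' <= u)%N -> (v' <= v)%N ->
  dominated q u v -> dominated q u' v'.
Proof.
move=> lu lv /existsP[p /and3P[lt hu hv]]; apply/existsP; exists p.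
by rewrite lt (leq_trans lu hu) (leq_trans lv hv).
Qed.

Definition column (q : T) (u : nat) : {set 'I_m} := [set v : 'I_m | dominated q u v.+2].

(** The down-set encoded by its column heights, for [u] from [m.+1] down to 2; in this order they
    are nondecreasing. *)
Definition profile (q : T) : m.-tuple 'I_m.+1 :=
  [tuple inord #|column q (m.+1 - i)| | i < m].

Lemma column_card q u : (#|column q u| < m.+1)%N.
Proof. by rewrite ltnS; apply: leq_trans (max_card _) _; rewrite card_ord. Qed.

Lemma profile_sorted q : sorted leq [seq val i | i <- profile q].
Proof.
apply: (@path.path_sorted _ _ 0%N); apply/(pathP 0%N); rewrite size_map size_tuple => i im.
have nthE j : (j < m)%N ->
    nth 0%N [seq val i | i <- profile q] j = #|column q (m.+1 - j)|.
  move=> jm; rewrite (nth_map ord0) ?size_tuple //.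
  rewrite -[j]/(val (Ordinal jm)) -tnth_nth tnth_mktuple /= inordK //.
  exact: column_card.
case: i im => [|i] im; first by [].
rewrite /= !nthE //; last exact: ltnW.
apply: subset_leq_card; apply/fintype.subsetP => v; rewrite !inE.
by apply: dominated_le => //; lia.
Qed.

(** A column is an initial segment of ['I_m], hence determined by its height. *)
Lemma profile_dominated p q u v : profile p = profile q ->
  (1 < u < m.+2)%N -> (1 < v < m.+2)%N -> dominated p u v = dominated q u v.
Proof.
move=> E /andP[u1 um] /andP[v1 vm].
have lt_i : (m.+1 - u < m)%N by lia.
have := congr1 (fun t => val (tnth t (Ordinal lt_i))) E.
rewrite !tnth_mktuple /= !inordK ?column_card // => cE.
have lt_v : (v - 2 < m)%N by lia.
have down r : forall i j : 'I_m, (i <= j)%N -> j \in column r (m.+1 - (m.+1 - u)) ->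
    i \in column r (m.+1 - (m.+1 - u)).
  by move=> i j ij; rewrite !inE; apply: dominated_le.
have /finset.setP/(_ (Ordinal lt_v)) := initial_segment_eq (down p) (down q) cE.
rewrite !inE /=; have -> : (m.+1 - (m.+1 - u))%N = u by lia.
by have -> : (v - 2).+2 = v by lia.
Qed.

(* A slope [s'] witnessing at [p] the pair that [p] forces at [q] can be neither
   smaller than [slope p q], because of the cups, nor larger, because of the caps. *)
Lemma profile_jump p q : profile p = profile q -> X p < X q ->
  (cup_len false p (slope p q) < cup_len true p (slope p q))%N.
Proof.
move=> E lt; set s := slope p q.
have hu := @cup_len_step _ _ X Y p q lt; have hv := @cup_len_step _ _ X Yo p q lt.
rewrite slopeN -/s in hu hv.
have bu := cup_len_lt true q s no_cup; have bv := cup_len_lt true q (- s) no_cap.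
have u0 := cup_len_gt0 X Y false p s; have v0 := cup_len_gt0 X Yo false p (- s).
have : dominated q (cup_len false p s).+1 (cap_len false p (- s)).+1.
  by apply/existsP; exists p; rewrite lt hu hv.
(* Both entries of the forced pair lie between 2 and [m.+1], the range that profiles record. *)
rewrite -(profile_dominated E); try by apply/andP; split; lia.
case/existsP=> p' /and3P[_]; set s' := slope p' p => hu' hv'.
have [lt'|lt'|eqs] := ltgtP s' s; last by move: hu'; rewrite eqs.
  by have := cup_len_mono X Y p lt'; lia.
have := @cup_len_mono _ _ X Yo p (- s') (- s); rewrite ltrN2 => /(_ lt'); lia.
Qed.

End Profiles.

Theorem cup_cap_bound : exists C : nat,
  forall (R : realFieldType) (T : finType) (X Y : T -> R) (m l : nat),
    injective X -> (0 < l)%N ->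
    (forall S, cup X Y S -> (#|S| < m.+2)%N) ->
    (forall S, cup X (fun z => - Y z) S -> (#|S| < m.+2)%N) ->
    (forall s c, (#|graph X Y s c| < l)%N) ->
  (#|T| <= 'C(2 * m, m) * (C * (m.+2 + l)))%N.
Proof.
have [C HC] := few_directions_bound; exists C => R T X Y m l injX l0 nocup nocap coll.
pose prof := profile X Y m.
pose tuples := [set t : m.-tuple 'I_m.+1 | sorted leq [seq val i | i <- t]].
(* The binomial coefficient counts nondecreasing [m]-tuples over ['I_m.+1], that is, the possible
   profiles. *)
rewrite mul2n -addnn -card_sorted_tuples -/tuples -sum_nat_const.
rewrite -sum1_card (partition_big prof (mem tuples)) /=; last first.
  by move=> q _; rewrite inE profile_sorted.
apply: leq_sum => t _; rewrite sum1dep_card.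
pose U : finType := {q : T | prof q == t}.
have cU : #|[set q : T | prof q == t]| = #|U|.
  by rewrite card_sig; apply: eq_card => q; rewrite !inE.
rewrite cU; apply: (HC R U (fun q => X (val q)) (fun q => Y (val q))) => //.
- by move=> x y /injX/val_inj.
(* Directions are named by [cup_len false], which is below [m.+2]. By [profile_jump] it grows
   strictly from one direction within the class to a steeper one, so equal names mean equal
   slopes. *)
- move=> x; exists (fun y => inord (cup_len X Y false (val x) (slope X Y (val x) (val y)))).
  have E (y : U) : prof (val x) = prof (val y).
    by rewrite (eqP (valP x)) (eqP (valP y)).
  have injh (y z : U) : X (val x) < X (val y) -> X (val x) < X (val z) ->
      cup_len X Y false (val x) (slope X Y (val x) (val y)) =
      cup_len X Y false (val x) (slope X Y (val x) (val z)) ->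
      slope X Y (val x) (val y) <= slope X Y (val x) (val z).
    move=> ly lz hE; rewrite leNgt; apply/negP => lt.
    have := cup_len_mono X Y (val x) lt.
    by have := profile_jump nocup nocap (E z) lz; lia.
  move=> y z ly lz /(congr1 val).
  rewrite /= !inordK; try by apply: cup_len_lt.
  by move=> hE; apply/eqP; rewrite eq_le; apply/andP; split; apply: injh.
- move=> s c; apply: leq_ltn_trans (coll s c).
  rewrite -(card_imset _ val_inj); apply: subset_leq_card.
  by apply/fintype.subsetP => y /imsetP[x]; rewrite !inE => h ->.
Qed.

Lemma card_eq_range (I : finType) (U : Type) (f : I -> U) : injective f ->
  (range f #= `I_#|I|)%card.
Proof.
move=> finj; have fE : (range f #= [set: I])%card.
  by apply: inj_card_eq => x y _ _; apply: finj.
apply: card_eq_trans fE _; rewrite card_eq_sym.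
apply: card_eq_trans card_II _.
apply/card_bijP.
exists (fun x : [set: 'I_#|I|]%classic => @SigSub _ _ _ (enum_val (val x)) (in_setT _)).
exists (fun x : [set: I]%classic => @SigSub _ _ _ (enum_rank (val x)) (in_setT _)) => x.
  by apply/val_inj; rewrite /= enum_valK.
by apply/val_inj; rewrite /= enum_rankK.
Qed.

(** * Dual lines and cells *)

Section EnvelopeCell.
Variables (R : realType) (I : finType) (a b : I -> R) (e : R).
Hypothesis e_sqr : e * e = 1.
Local Open Scope classical_set_scope.

Definition graph_line (i : I) : set (R * R) := [set p | p.2 = a i * p.1 + b i].

Hypothesis graph_line_inj : injective graph_line.

(* The cell below all the lines if [e = 1], above all of them if [e = -1]. *)
Definition envelope_cell : set (R * R) :=
  [set p | forall i, e * p.2 < e * (a i * p.1 + b i)].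

Let gap i (p : R * R) : R := e * p.2 - e * (a i * p.1 + b i).

Lemma gap_eq0 i p : gap i p = 0 -> graph_line i p.
Proof.
rewrite /gap /graph_line /= => H.
have : e * (e * p.2 - e * (a i * p.1 + b i)) = 0 by rewrite H mulr0.
by rewrite mulrBr !mulrA e_sqr !mul1r; lra.
Qed.

Lemma graph_line_gap i p : graph_line i p -> gap i p = 0.
Proof. by rewrite /gap /graph_line /= => ->; rewrite subrr. Qed.

Lemma gap_continuous i : continuous (gap i).
Proof.
move=> p; apply: cvgB; first by apply: cvgM; [exact: cvg_cst|exact: cvg_snd].
apply: cvgM; first exact: cvg_cst.
apply: cvgD; last exact: cvg_cst.
by apply: cvgM; [exact: cvg_cst|exact: cvg_fst].
Qed.

(** At abscissa 0 the lines have heights [b i], and this point lies beyond all of them. *)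
Lemma envelope_cell_nonempty : envelope_cell (0, - e * (1 + \sum_i `|b i|)).
Proof.
move=> i /=; rewrite mulr0 add0r mulrA mulrN e_sqr mulN1r.
have h1 : `|b i| <= \sum_j `|b j|.
  by rewrite (bigD1 i) //= lerDl sumr_ge0.
have h2 : `|e * b i| = `|b i|.
  have : `|e| * `|e| = 1 by rewrite -normrM e_sqr normr1.
  rewrite normrM => e1; suff -> : `|e| = 1 by rewrite mul1r.
  by have := normr_ge0 e; nra.
have h3 := ler_norm (- (e * b i)); rewrite normrN h2 in h3.
lra.
Qed.

Let U : set (R * R) := ~` (\bigcup_(A in range graph_line) A).

Lemma envelope_cell_sub : envelope_cell `<=` U.
Proof.
move=> p pP [_ [i _ <-]] /graph_line_gap; rewrite /gap => /eqP.
by rewrite subr_eq0 lt_eqF.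
Qed.

(** The cell is convex, so segments join its points inside the complement. Conversely, a connected
    set leaving the cell takes both signs of some [gap i], hence meets that line. *)
Lemma envelope_cell_component p : envelope_cell p ->
  envelope_cell = connected_component U p.
Proof.
move=> pP; apply/seteqP; split=> z.
- move=> zP; pose C := [set p + t *: (z - p) | t in `[0 : R, 1]].
  have Cp : C p by exists 0; rewrite ?scale0r ?addr0 //= in_itv /= lexx ler01.
  have Cz : C z.
    by exists 1; rewrite ?scale1r ?[_ + (_ - _)]addrC ?subrK //= in_itv /= ler01 lexx.
  have CU : C `<=` U.
    apply: subset_trans envelope_cell_sub => _ [t t01 <-] i.
    move: t01; rewrite /= in_itv /= => /andP[t0 t1].
    have := pP i; have := zP i => hz hp.
    have [->|tn0] := eqVneq t 0; first by rewrite !scale0r !addr0.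
    have tp : 0 < t by rewrite lt_neqAle eq_sym tn0.
    have h1 : 0 < t * (e * (a i * z.1 + b i) - e * z.2) by rewrite mulr_gt0 // subr_gt0.
    have h2 : 0 <= (1 - t) * (e * (a i * p.1 + b i) - e * p.2).
      by rewrite mulr_ge0 ?subr_ge0 // ltW.
    rewrite /GRing.scale /=; lra.
  have Cc : connected C.
    apply: connected_continuous_connected; first exact: segment_connected.
    apply: continuous_subspaceT => t.
    apply: cvgD; first exact: cvg_cst.
    by apply: cvgZr_tmp; exact: cvg_id.
  by apply: (connected_component_max Cp CU Cc).
- move=> [C [Cp CU Cc] Cz] i; rewrite ltNge; apply/negP => le.
  have gC : connected (gap i @` C).
    by apply: connected_continuous_connected => //; apply/continuous_subspaceT/gap_continuous.
  have /connected_intervalP itvC := gC.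
  have [] : (gap i @` C) 0.
    apply: (itvC (gap i p) (gap i z)); [by exists p|by exists z|].
    by rewrite /gap subr_ge0 le subr_le0 ltW ?pP.
  by move=> w Cw /gap_eq0 wi; apply: (CU w Cw); exists (graph_line i) => //; exists i.
Qed.

Hypothesis exposed : forall i, exists x1 x2, x1 != x2 /\ forall j, j != i ->
  e * (a i * x1 + b i) < e * (a j * x1 + b j) /\
  e * (a i * x2 + b i) < e * (a j * x2 + b j).

Lemma exposed_boundary i (p : R * R) : graph_line i p ->
    (forall j, j != i -> e * p.2 < e * (a j * p.1 + b j)) ->
  boundary envelope_cell p.
Proof.
move=> ip lt; split; last first.
  by move=> /interior_subset /(_ i); rewrite ip ltxx.
move=> B /nbhs_ballP[d /= d0 dB].
(* A vertical move by half the radius enters the cell. *)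
exists (p.1, p.2 - e * (d / 2)); split.
  move=> j /=; rewrite mulrBr mulrA e_sqr mul1r.
  have [->|ne] := eqVneq j i; last by have := lt j ne; lra.
  by rewrite -ip; lra.
apply: dB; split; first exact: ballxx.
have ne1 : `|e| = 1.
  have : `|e| * `|e| = 1 by rewrite -normrM e_sqr normr1.
  by have := normr_ge0 e; nra.
rewrite /ball /= opprB addrC subrK normrM ne1 mul1r gtr0_norm; lra.
Qed.

(** Strict inequalities between affine functions at [x1] and [x2] persist in between, so every line
    has a whole segment on the boundary of the cell. *)
Theorem exposed_convex_position : convex_position #|I| (range graph_line).
Proof.
split; first exact: card_eq_range.
exists envelope_cell; split.
  exists (0, - e * (1 + \sum_i `|b i|)).
    exact: (envelope_cell_sub envelope_cell_nonempty).
  exact: envelope_cell_component envelope_cell_nonempty.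
rewrite (_ : [set A | _] = range graph_line); first exact: card_eq_range.
apply/seteqP; split=> [A []//|_ [i _ <-]]; split; first by exists i.
have [x1 [x2 [ne H]]] := exposed i.
exists (x1, a i * x1 + b i), (x2, a i * x2 + b i); split.
  by move=> [] /eqP; rewrite (negPf ne).
move=> _ [t t01 <-]; set q := _ + _.
move: t01; rewrite /= in_itv /= => /andP[t0 t1].
have q1 : q.1 = (1 - t) * x1 + t * x2.
  by rewrite /q /= /GRing.scale /=; ring.
have q2 : q.2 = (1 - t) * (a i * x1 + b i) + t * (a i * x2 + b i).
  by rewrite /q /= /GRing.scale /=; ring.
have iq : graph_line i q by rewrite /graph_line /mkset q1 q2; ring.
split=> //; apply: exposed_boundary iq _ => j /H [h1 h2].
have [tE|tn1] := eqVneq t 1.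
  by rewrite q1 q2 tE subrr !mul0r !add0r !mul1r.
have p1 : 0 < (1 - t) * (e * (a j * x1 + b j) - e * (a i * x1 + b i)).
  by rewrite mulr_gt0 ?subr_gt0 // lt_neqAle tn1.
have p2 : 0 <= t * (e * (a j * x2 + b j) - e * (a i * x2 + b i)).
  by rewrite mulr_ge0 ?subr_ge0 // ltW.
rewrite q1 q2; lra.
Qed.

End EnvelopeCell.

(** It provides an interval of supporting slopes at a point of a cup, hence two different abscissae
    where the dual line is exposed. *)
Lemma finite_separation (R : realFieldType) (I : finType) (P Q : pred I) (f : I -> R) :
    (forall i j, P i -> Q j -> f i < f j) ->
  exists s1 s2, [/\ s1 < s2, forall i, P i -> f i < s1 & forall j, Q j -> s2 < f j].
Proof.
move=> PQ.
suff [u [v [uv Pu Qv]]] : exists u v, [/\ u < v, forall i, P i -> f i <= u &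
    forall j, Q j -> v <= f j].
  exists (u + (v - u) / 3), (v - (v - u) / 3); split; first by lra.
    by move=> i /Pu; lra.
  by move=> j /Qv; lra.
case: (pickP P) => [i0 Pi0|P0]; case: (pickP Q) => [j0 Qj0|Q0].
- case: (Order.TotalTheory.arg_maxP f Pi0) => i Pi imax.
  case: (Order.TotalTheory.arg_minP f Qj0) => j Qj jmin.
  by exists (f i), (f j); split; [exact: PQ|exact: imax|exact: jmin].
- case: (Order.TotalTheory.arg_maxP f Pi0) => i Pi imax.
  by exists (f i), (f i + 1); split; [lra|exact: imax|move=> j; rewrite Q0].
- case: (Order.TotalTheory.arg_minP f Qj0) => j Qj jmin.
  by exists (f j - 1), (f j); split; [lra|move=> i; rewrite P0|exact: jmin].
- by exists 0, 1; split; [lra|move=> i; rewrite P0|move=> j; rewrite Q0].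
Qed.

Lemma subset_of_card (T : finType) (S : {set T}) k : (k <= #|S|)%N ->
  exists2 S' : {set T}, S' \subset S & #|S'| = k.
Proof.
move=> kS; have sz : size (take k (enum S)) = k.
  by rewrite size_takel // -cardE.
exists [set x in take k (enum S)].
  by apply/fintype.subsetP => x; rewrite inE => /mem_take; rewrite mem_enum.
by rewrite cardsE (card_uniqP _) // take_uniq ?enum_uniq.
Qed.

Section Duality.
Variables (R : realType) (T : finType) (a b : T -> R).
Hypothesis a_inj : injective a.
Local Notation lines := (graph_line a b).

Lemma graph_line_injective : injective lines.
Proof.
move=> i j E; apply: a_inj.
have h0 : lines j (0, b i) by rewrite -E /graph_line /= mulr0 add0r.
have h1 : lines j (1, a i + b i) by rewrite -E /graph_line /= mulr1.
by move: h0 h1; rewrite /graph_line /= mulr0 mulr1 add0r => ->; lra.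
Qed.

(* The line dual to [i] is exposed at abscissa [- e * s] exactly when [s] is
   the slope of a supporting line of the cup at [i]. *)
Lemma cup_exposed (e : R) : e * e = 1 -> cup a (fun z => e * b z) [set: T] ->
  forall i, exists x1 x2, x1 != x2 /\ forall j, j != i ->
    e * (a i * x1 + b i) < e * (a j * x1 + b j) /\
    e * (a i * x2 + b i) < e * (a j * x2 + b j).
Proof.
move=> ee /cupP cupT i; pose f j := slope a (fun z => e * b z) i j.
have [s1 [s2 [s12 lo hi]]] : exists s1 s2, [/\ s1 < s2,
    forall j, a j < a i -> f j < s1 & forall j, a i < a j -> s2 < f j].
  apply: finite_separation => j k ji ik.
  by rewrite /f slopeC; apply: cupT; rewrite ?inE.
have e0 : e != 0 by apply: contra_eq_neq ee => ->; rewrite mul0r eq_sym oner_neq0.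
exists (- e * s1), (- e * s2); split.
  by rewrite !mulNr eqr_opp (inj_eq (mulfI e0)) lt_eqF.
have key s j : s1 <= s <= s2 -> j != i ->
    e * (a i * (- e * s) + b i) < e * (a j * (- e * s) + b j).
  move=> /andP[ls sl] ne.
  have E k : e * (a k * (- e * s) + b k) = e * b k - s * a k.
    transitivity (e * b k - (e * e) * (s * a k)); first by ring.
    by rewrite ee mul1r.
  rewrite !E; move: ne; rewrite -(inj_eq a_inj) neq_lt => /orP[ji|ij].
    have h := slopeE (fun z => e * b z) ji; have := lo _ ji.
    rewrite /f slopeC => lt.
    have : 0 < (s - slope a (fun z => e * b z) j i) * (a i - a j).
      by rewrite mulr_gt0 ?subr_gt0 // (lt_le_trans lt).
    by rewrite h; lra.
  have h := slopeE (fun z => e * b z) ij; have := hi _ ij; rewrite /f => lt.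
  have : 0 < (slope a (fun z => e * b z) i j - s) * (a j - a i).
    by rewrite mulr_gt0 ?subr_gt0 // (le_lt_trans sl).
  by rewrite h; lra.
by move=> j ne; split; apply: key; rewrite ?lexx ?ltW.
Qed.

End Duality.

Section SubFamilies.
Variables (R : realType) (T : finType) (a b : T -> R).
Hypothesis a_inj : injective a.
Local Notation lines := (graph_line a b).

(** The lines dual to [S], indexed by a subtype so that results about a full finite index type
    apply. *)
Definition subfamily (S : {set T}) : set (set (R * R)) :=
  range (graph_line (fun x : {i : T | i \in S} => a (val x)) (fun x => b (val x))).

Let restrict_inj (S : {set T}) : injective (fun x : {i : T | i \in S} => a (val x)).
Proof. by move=> x y /a_inj/val_inj. Qed.

Lemma subfamily_sub (S : {set T}) : (subfamily S `<=` range lines)%classic.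
Proof. by move=> _ [x _ <-]; exists (val x). Qed.

Lemma card_subset_sig (S : {set T}) : #|{: {i : T | i \in S}}| = #|S|.
Proof. by rewrite card_sig; apply: eq_card => x; rewrite !inE. Qed.

Lemma subfamily_card (S : {set T}) : (subfamily S #= `I_#|S|)%card.
Proof.
rewrite -card_subset_sig; apply: card_eq_range.
by apply: graph_line_injective; apply: restrict_inj.
Qed.

(** The sign [e = 1] treats cups and [e = -1] treats caps. *)
Lemma cup_convex_position (e : R) (S : {set T}) : e * e = 1 ->
  cup a (fun z => e * b z) S -> convex_position #|S| (subfamily S).
Proof.
move=> ee /cupP cupS; rewrite -card_subset_sig.
apply: (@exposed_convex_position _ _ _ _ e) => //.
  by apply: graph_line_injective; apply: restrict_inj.
apply: cup_exposed => //; first exact: restrict_inj.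
apply/cupP => i j k _ _ _ ij jk; apply: cupS => //; exact: valP.
Qed.

(** The line of points [y = s * x + c] is dual to the point [(- s, c)]. *)
Lemma graph_concurrent (s c : R) (S : {set T}) : S \subset graph a b s c ->
  concurrent (subfamily S).
Proof.
move=> /fintype.subsetP sub; exists (- s, c) => _ [x _ <-].
have := sub _ (valP x); rewrite inE /graph_line /= => /eqP ->; lra.
Qed.

End SubFamilies.

(** * The bound for families of lines *)

Theorem ES_property_bound : exists C : nat, forall (R : realType) (m l : nat),
  (0 < l)%N -> ES_property R l m.+2 ('C(2 * m, m) * (C * (m.+2 + l))).+1.
Proof.
have [C HC] := cup_cap_bound; exists C => R m l l0 L [_ lineL npar nvert] cardL.
set N := (_.+1) in cardL.
have [F [Fsub Finj Fsurj]] : exists F : 'I_N -> set (R * R), set_bij setT L F.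
  apply/card_set_bijP; apply: card_eq_trans (card_esym cardL).
  by rewrite card_eq_sym; apply: card_II.
have [g gP] : exists g : 'I_N -> R * R, forall i,
    F i = [set p | p.2 = (g i).1 * p.1 + (g i).2]%classic.
  apply: (@fin_all_exists _ _ (fun i y =>
    F i = [set p | p.2 = y.1 * p.1 + y.2]%classic)) => i.
  have LF : L (F i) by apply: Fsub.
  have [p [q [c [pq0 FE]]]] := lineL _ LF.
  have q0 : q != 0.
    apply/eqP => q0; apply: (nvert _ LF); exists (c / p); rewrite FE q0.
    have p0 : p != 0 by move: pq0; rewrite q0 xpair_eqE eqxx andbT.
    apply/seteqP; split=> z /=; rewrite mul0r addr0; [move=> <-|move=> ->].
      by rewrite mulrAC divff // mul1r.
    by rewrite mulrC divfK.
  exists (- p / q, c / q); rewrite FE; apply/seteqP; split=> z /=.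
    by move=> <-; field.
  by move=> ->; field.
pose a i := (g i).1; pose b i := (g i).2.
have FE : F = graph_line a b by apply/funext => i; rewrite gP.
(* Different lines with equal slopes would be disjoint, hence parallel; so the dual points have
   distinct abscissae. *)
have a_inj : injective a.
  move=> i j aij; apply/eqP/negP => /negP ij.
  have nE : F i <> F j by move=> /(Finj _ _ (in_setT _) (in_setT _))/eqP; rewrite (negPf ij).
  apply: (npar _ _ (Fsub i _) (Fsub j _) nE) => //; right.
  apply/seteqP; split=> // p [].
  rewrite FE /graph_line /= aij => -> /addrI bij.
  by apply: nE; rewrite FE /graph_line aij bij.
have rangeL : (range (graph_line a b) `<=` L)%classic.
  by rewrite -FE => _ [i _ <-]; apply: Fsub.
have subL S : (subfamily a b S `<=` L)%classic.
  exact: subset_trans (@subfamily_sub _ _ a b S) rangeL.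
have [[s [c lsc]]|few] := pselect (exists s c, (l <= #|graph a b s c|)%N).
  left; have [S Ssub Sl] := subset_of_card lsc; exists (subfamily a b S).
  split; [exact: subL|by rewrite -Sl; apply: subfamily_card|].
  exact: graph_concurrent Ssub.
right; apply: contrapT => noconv.
have nocup e (S : {set 'I_N}) : e * e = 1 -> cup a (fun z => e * b z) S -> (#|S| < m.+2)%N.
  move=> ee cS; rewrite ltnNge; apply/negP => /subset_of_card[S' S'sub S'm].
  apply: noconv; exists (subfamily a b S'); split; first exact: subL.
  by rewrite -S'm; apply: (cup_convex_position a_inj ee); apply: cup_sub S'sub cS.
have : (#|'I_N| <= 'C(2 * m, m) * (C * (m.+2 + l)))%N.
  apply: (HC R _ a b) => // [S|S|s c].
  - by rewrite (_ : b = fun z => 1 * b z); [apply: nocup; rewrite mulr1|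
      apply/funext => z; rewrite mul1r].
  - rewrite (_ : (fun z => - b z) = fun z => -1 * b z); last first.
      by apply/funext => z; rewrite mulN1r.
    by apply: nocup; rewrite mulrNN mulr1.
  - by rewrite ltnNge; apply/negP => lsc; apply: few; exists s, c.
by rewrite card_ord ltnn.
Qed.

Theorem theorem1p1 (R : realType) :
  exists c : R, 1 < c /\
    forall l n : nat, (3 <= l)%N -> (3 <= n)%N ->
      exists N : nat, is_ES R l n N /\
        N%:R <= c * (n%:R + l%:R - 1) * 'C(2 * n - 4, n - 2)%:R.
Proof.
have [C HC] := ES_property_bound.
(* Since [n + l <= 2 * (n + l - 1)], the part [2 * C] covers the main term; the part 2 covers the
   added 1, as the binomial is at least 1. *)
exists (2 * C%:R + 2); split; first by have := ler0n R C; lra.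
move=> l n l3 n3; have [m nE] : exists m, n = m.+2 by exists (n - 2)%N; lia.
have ES0 : ES_property R l n ('C(2 * m, m) * (C * (m.+2 + l))).+1.
  by rewrite nE; apply: HC; lia.
have exES : exists N, `[< ES_property R l n N >].
  by exists ('C(2 * m, m) * (C * (m.+2 + l))).+1; apply/asboolP.
case: (ex_minnP exES) => N /asboolP ESN minN; exists N; split.
  by split=> // N' /asboolP; apply: minN.
have := minN _ (introT (asboolP _) ES0).
have -> : (2 * n - 4 = 2 * m)%N by lia.
have -> : (n - 2 = m)%N by lia.
rewrite -(ler_nat R) -nE => /le_trans; apply.
have B1 : 1 <= 'C(2 * m, m)%:R :> R by rewrite ler1n bin_gt0; lia.
have n1 : 3%:R <= n%:R :> R by rewrite ler_nat.
have l1 : 3%:R <= l%:R :> R by rewrite ler_nat.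
rewrite -natr1 !(natrM, natrD).
move: ('C(2 * m, m)%:R : R) (n%:R : R) (l%:R : R) (C%:R : R) (ler0n R C) B1 n1 l1.
move=> B x y k k0 B1 x3 y3.
clear nE; have p1 : 0 <= B * k * (x + y - 2) by rewrite !mulr_ge0 //; lra.
have p2 : 0 <= (B - 1) * (x + y - 1) by apply: mulr_ge0; lra.
lra.
Qed.
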